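(* Let $K$ be a perfect (commutative) semi-ring of characteristic $1$. Let $\rho\in K$, $\rho\preccurlyeq 1$, be a multiplicatively cancellative element and let $K_\rho$ be the localized semi-ring $S^{-1}K$, $S=\{\rho^n\mid n\in\mathbb{N}\}$. Then the formula $$x+_\rho y:=\int^{\uplus}_{s\in[0,1]}\rho^{-S(s)}\,x^s\,y^{1-s}\qquad (x,y\in K_\rho)$$ defines an associative law on $K_\rho$ with $0$ as neutral element. The multiplication of $K_\rho$ is distributive with respect to this law. These operations turn the Grothendieck group of the additive monoid $(K_\rho,+_\rho)$ into an algebra $W(K,\rho)$ over $\mathbb{R}$ which depends functorially upon $(K,\rho)$.
   Context: A semi-ring $(R,+,\cdot)$ is a non-empty set with $(R,+)$ a commutative monoid with neutral element $0$, $(R,\cdot)$ a monoid with identity $1$, two-sided distributivity, $r0=0r=0$, and $0\neq1$. It has characteristic $1$ if $1+1=1$; then its addition is denoted $\uplus$, one has $a\uplus a=a$ for all $a$, and $a\preccurlyeq b\Leftrightarrow a\uplus b=b$ defines a partial order in which $a\uplus b$ is the supremum of $a,b$. A commutative semi-ring $R$ of characteristic $1$ is called perfect when it is equipped with a one-parameter group of automorphisms $\vartheta_\lambda\in\mathrm{Aut}(R)$, $\lambda\in\mathbb{R}_+^*$, such that $\vartheta_n(x)=x^n$ for all positive integers $n$ and $x\in R$; $\vartheta_\lambda\circ\vartheta_\mu=\vartheta_{\lambda\mu}$; and $\vartheta_\lambda(x)\vartheta_\mu(x)=\vartheta_{\lambda+\mu}(x)$ for all $\lambda,\mu\in\mathbb{R}_+^*$,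 $x\in R$. One writes $x^\lambda=\vartheta_\lambda(x)$ and $x^0=1$. An element $\rho$ is multiplicatively cancellative when multiplication by $\rho$ is injective. The automorphisms $\vartheta_\lambda$ extend uniquely to $K_\rho$, which is again a perfect semi-ring of characteristic $1$; in $K_\rho$ the element $\rho$ is invertible, so $\rho^{\lambda}$ makes sense for all $\lambda\in\mathbb{R}$. $S(s)=-s\log s-(1-s)\log(1-s)$ for $s\in[0,1]$ (with $0\log 0=0$). The idempotent integral $\int^{\uplus}_{s\in Y}f(s)$ is the least upper bound, for $\preccurlyeq$, of the range $f(Y)$. Standing assumption: the idempotent integrals of the functions involved exist and can be manipulated in the usual way (they commute with multiplication by elements, with the automorphisms $\vartheta_\lambda$, and iterated integrals may be combined). The Grothendieck group of the additive monoid of a semi-ring carries the natural extension of the product. The algebra $W(K,\rho)$ is allowed to be the degenerate algebra $\{0\}$ (in which $1=0$). Functoriality refers to semi-ring homomorphisms $K\to K'$ sending $\rho$ to $\rho'$ and compatible with the automorphisms $\vartheta_\lambda$ and with the idempotent integrals involved. *)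

(* Defs.v *)
From HB Require Import structures.
From mathcomp Require Import all_boot all_order all_algebra generic_quotient.
From mathcomp Require Import all_classical reals exp.
From mathcomp Require Import ring.

Set Implicit Arguments.
Unset Strict Implicit.
Unset Printing Implicit Defensive.

Import Order.TTheory GRing.Theory Num.Theory.
Local Open Scope ring_scope.
Local Open Scope quotient_scope.
Local Open Scope classical_set_scope.

HB.mixin Record hasCharOne K of GRing.ComNzSemiRing K := {
  addr11 : 1 + 1 = 1 :> K
}.

#[short(type="charOneType")]
HB.structure Definition CharOne := {K of GRing.ComNzSemiRing K & hasCharOne K}.

Section IdempotentIntegral.
Variable K : charOneType.

Definition preceq (a b : K) : Prop := a + b = b.

Definition is_lub (A : set K) (b : K) : Prop :=
  (forall a, A a -> preceq a b) /\
  (forall c, (forall a, A a -> preceq a c) -> preceq b c).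

(* The default value 0 is used only when there is no least upper bound. *)
Definition idem_int (T : Type) (Y : set T) (f : T -> K) : K :=
  xget 0 [set b | is_lub (f @` Y) b].

(* The idempotent integral of f over Y exists, and multiplication by any
   element commutes with it. *)
Definition idem_integrable (T : Type) (Y : set T) (f : T -> K) : Prop :=
  exists2 b, is_lub (f @` Y) b &
    forall c, is_lub ((fun t => c * f t) @` Y) (c * b).

End IdempotentIntegral.

(* Only the values theta l with 0 < l are meaningful.  Each of them is bijective
   (lemma theta_bij), hence an automorphism. *)
HB.mixin Record isPerfect (R : realType) K of CharOne K := {
  theta : R -> K -> K;
  theta_nmod : forall l, 0 < l -> nmod_morphism (theta l);
  theta_monoid : forall l, 0 < l -> monoid_morphism (theta l);
  theta_nat : forall n x, (0 < n)%N -> theta n%:R x = x ^+ n;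
  theta_comp : forall l m x, 0 < l -> 0 < m ->
    theta l (theta m x) = theta (l * m) x;
  thetaD : forall l m x, 0 < l -> 0 < m ->
    theta l x * theta m x = theta (l + m) x
}.

#[short(type="perfectType")]
HB.structure Definition Perfect (R : realType) := {K of isPerfect R K & CharOne K}.

Section PerfectTheory.
Variables (R : realType) (K : perfectType R).
Implicit Types (l m : R) (x y : K).

Lemma theta0 l : 0 < l -> theta l (0 : K) = 0.
Proof. by case/(@theta_nmod R K). Qed.

Lemma theta_add l x y : 0 < l -> theta l (x + y) = theta l x + theta l y.
Proof. by case/(@theta_nmod R K). Qed.

Lemma theta1 l : 0 < l -> theta l (1 : K) = 1.
Proof. by case/(@theta_monoid R K). Qed.

Lemma thetaM l x y : 0 < l -> theta l (x * y) = theta l x * theta l y.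
Proof. by case/(@theta_monoid R K). Qed.

Lemma theta_id x : theta (1 : R) x = x.
Proof. by have := @theta_nat R K 1 x isT; rewrite expr1. Qed.

Lemma theta_bij l : 0 < l -> bijective (theta l : K -> K).
Proof.
move=> l0; have li : 0 < l^-1 by rewrite invr_gt0.
exists (theta l^-1) => x; rewrite theta_comp // ?mulVf ?mulfV ?theta_id //;
  exact: lt0r_neq0.
Qed.

(* x ^ l for l >= 0; in particular 0 ^ 0 = 1 *)
Definition ppow x l : K := if l == 0 then 1 else theta l x.

Lemma ppow0 x : ppow x 0 = 1.
Proof. by rewrite /ppow eqxx. Qed.

Lemma ppow_theta l x : 0 < l -> ppow x l = theta l x.
Proof. by move=> l0; rewrite /ppow gt_eqF. Qed.

Lemma ppowD l m x : 0 <= l -> 0 <= m -> ppow x l * ppow x m = ppow x (l + m).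
Proof.
rewrite !le0r => /orP[/eqP->|l0] /orP[/eqP->|m0];
  rewrite ?ppow0 ?mul1r ?mulr1 ?add0r ?addr0 ?ppow0 //.
by rewrite !ppow_theta ?addr_gt0 // thetaD.
Qed.

Lemma ppow_nat n x : ppow x n%:R = x ^+ n.
Proof. by case: n => [|n]; rewrite ?ppow0 // ppow_theta ?theta_nat ?ltr0n. Qed.

Lemma theta_ppow l m x : 0 < l -> 0 <= m -> theta l (ppow x m) = ppow x (l * m).
Proof.
move=> l0; rewrite le0r => /orP[/eqP->|m0]; first by rewrite mulr0 !ppow0 theta1.
by rewrite !ppow_theta ?theta_comp ?mulr_gt0.
Qed.

End PerfectTheory.

Record cancellative (K : comNzSemiRingType) := Cancellative {
  cval :> K;
  cvalP : injective ( *%R cval)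
}.

Section Localization.
Variables (K : comNzSemiRingType) (rho : cancellative K).
Local Notation r := (cval rho).

(* The pair (x, n) stands for the fraction x / rho ^ n. *)
Definition loc_eq (p q : K * nat) : bool :=
  `[< exists k, r ^+ k * (p.1 * r ^+ q.2) = r ^+ k * (q.1 * r ^+ p.2) >].

Lemma rhoXI k : injective ( *%R (r ^+ k)).
Proof.
elim: k => [|k IH] x y; first by rewrite expr0 !mul1r.
by rewrite exprS -!mulrA => /(@cvalP _ rho) /IH.
Qed.

Lemma loc_eqP p q : reflect (p.1 * r ^+ q.2 = q.1 * r ^+ p.2) (loc_eq p q).
Proof.
by apply: (iffP idP) => [/asboolP[k /rhoXI]//|e]; apply/asboolP; exists 0%N; rewrite e.
Qed.

Lemma loc_eq_refl : reflexive loc_eq.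
Proof. by move=> p; apply/loc_eqP. Qed.

Lemma loc_eq_sym : symmetric loc_eq.
Proof. by move=> p q; apply/loc_eqP/loc_eqP => ->. Qed.

Lemma loc_eq_trans : transitive loc_eq.
Proof.
move=> q p t /loc_eqP pq /loc_eqP qt; apply/loc_eqP/(@rhoXI q.2).
have -> : r ^+ q.2 * (p.1 * r ^+ t.2) = (p.1 * r ^+ q.2) * r ^+ t.2 by ring.
by rewrite pq mulrAC qt; ring.
Qed.

Canonical loc_equiv := EquivRel loc_eq loc_eq_refl loc_eq_sym loc_eq_trans.

Definition loc := {eq_quot loc_eq}.
HB.instance Definition _ : EqQuotient _ loc_eq loc := EqQuotient.on loc.
HB.instance Definition _ := Choice.on loc.

Definition lfrac (x : K) (n : nat) : loc := \pi_loc (x, n).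

Lemma lfrac_eqP x n y m : lfrac x n = lfrac y m <-> x * r ^+ m = y * r ^+ n.
Proof.
split=> [/eqP|e]; first by rewrite /lfrac eqmodE => /loc_eqP.
by apply/eqP; rewrite /lfrac eqmodE; apply/loc_eqP.
Qed.

Lemma lfracP (u : loc) : exists p : K * nat, u = lfrac p.1 p.2.
Proof. by exists (repr u); rewrite /lfrac -surjective_pairing reprK. Qed.

Definition loc_add (u v : loc) : loc :=
  lfrac ((repr u).1 * r ^+ (repr v).2 + (repr v).1 * r ^+ (repr u).2)
       ((repr u).2 + (repr v).2).

Definition loc_mul (u v : loc) : loc :=
  lfrac ((repr u).1 * (repr v).1) ((repr u).2 + (repr v).2).

Lemma repr_lfrac x n :
  (repr (lfrac x n)).1 * r ^+ n = x * r ^+ (repr (lfrac x n)).2.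
Proof. by apply/lfrac_eqP; rewrite /lfrac -surjective_pairing reprK. Qed.

Lemma loc_addE x n y m :
  loc_add (lfrac x n) (lfrac y m) = lfrac (x * r ^+ m + y * r ^+ n) (n + m).
Proof.
apply/lfrac_eqP; have := repr_lfrac x n; have := repr_lfrac y m.
move: (repr (lfrac y m)) (repr (lfrac x n)) => [y' m'] [x' n'] /= ey ex.
rewrite !exprD; transitivity
  ((x' * r ^+ n) * (r ^+ m' * r ^+ m) + (y' * r ^+ m) * (r ^+ n' * r ^+ n)).
  by ring.
by rewrite ex ey; ring.
Qed.

Lemma loc_mulE x n y m : loc_mul (lfrac x n) (lfrac y m) = lfrac (x * y) (n + m).
Proof.
apply/lfrac_eqP; have := repr_lfrac x n; have := repr_lfrac y m.
move: (repr (lfrac y m)) (repr (lfrac x n)) => [y' m'] [x' n'] /= ey ex.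
by rewrite !exprD mulrACA ex ey mulrACA.
Qed.

Lemma loc_addA : associative loc_add.
Proof.
move=> u v w.
have [[x n] ->] := lfracP u; have [[y m] ->] := lfracP v; have [[z k] ->] := lfracP w.
by rewrite /= !loc_addE addnA; congr lfrac; rewrite !exprD; ring.
Qed.

Lemma loc_addC : commutative loc_add.
Proof.
move=> u v; have [[x n] ->] := lfracP u; have [[y m] ->] := lfracP v.
by rewrite /= !loc_addE addrC addnC.
Qed.

Lemma loc_add0 : left_id (lfrac 0 0) loc_add.
Proof.
by move=> u; have [[x n] ->] := lfracP u; rewrite /= loc_addE mul0r add0r mulr1.
Qed.

HB.instance Definition _ :=
  GRing.isNmodule.Build loc loc_addA loc_addC loc_add0.

Lemma loc_mulA : associative loc_mul.
Proof.
move=> u v w.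
have [[x n] ->] := lfracP u; have [[y m] ->] := lfracP v; have [[z k] ->] := lfracP w.
by rewrite /= !loc_mulE mulrA addnA.
Qed.

Lemma loc_mulC : commutative loc_mul.
Proof.
move=> u v; have [[x n] ->] := lfracP u; have [[y m] ->] := lfracP v.
by rewrite /= !loc_mulE mulrC addnC.
Qed.

Lemma loc_mul1 : left_id (lfrac 1 0) loc_mul.
Proof. by move=> u; have [[x n] ->] := lfracP u; rewrite /= loc_mulE mul1r. Qed.

Lemma loc_mulDl : left_distributive loc_mul loc_add.
Proof.
move=> u v w.
have [[x n] ->] := lfracP u; have [[y m] ->] := lfracP v; have [[z k] ->] := lfracP w.
by rewrite /= !(loc_mulE, loc_addE); apply/lfrac_eqP; rewrite !exprD; ring.
Qed.

Lemma loc_mul0 : left_zero (lfrac 0 0) loc_mul.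
Proof.
move=> u; have [[x n] ->] := lfracP u; rewrite /= loc_mulE mul0r.
by apply/lfrac_eqP; rewrite !mul0r.
Qed.

Lemma loc_1neq0 : lfrac 1 0 != lfrac 0 0.
Proof.
by apply/eqP => /lfrac_eqP; rewrite mul0r mulr1 => /eqP; rewrite oner_eq0.
Qed.

HB.instance Definition _ := GRing.Nmodule_isComNzSemiRing.Build loc
  loc_mulA loc_mulC loc_mul1 loc_mulDl loc_mul0 loc_1neq0.

Definition loc_rho_inv : loc := lfrac 1 1.

Lemma lfracM x n y m : lfrac x n * lfrac y m = lfrac (x * y) (n + m).
Proof. exact: loc_mulE. Qed.

Lemma lfracD x n y m :
  lfrac x n + lfrac y m = lfrac (x * r ^+ m + y * r ^+ n) (n + m).
Proof. exact: loc_addE. Qed.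

Lemma rho_invK : lfrac r 0 * loc_rho_inv = 1.
Proof. by rewrite lfracM; apply/lfrac_eqP; rewrite !mulr1 mul1r. Qed.

End Localization.

(* The map K_rho -> K'_rho' sending x / rho ^ n to f x / rho' ^ n; it is well
   defined when f rho = rho' (lemma loc_map_lfrac). *)
Definition loc_map (K K' : comNzSemiRingType) (rho : cancellative K)
    (rho' : cancellative K') (f : K -> K') (u : loc rho) : loc rho' :=
  lfrac rho' (f (repr u).1) (repr u).2.

Lemma loc_map_lfrac (K K' : comNzSemiRingType) (rho : cancellative K)
    (rho' : cancellative K') (f : {rmorphism K -> K'}) x n :
  f (cval rho) = cval rho' -> loc_map rho' f (lfrac rho x n) = lfrac rho' (f x) n.
Proof.
move=> frho; apply/lfrac_eqP.
by rewrite -frho -!rmorphXn -!rmorphM repr_lfrac.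
Qed.

Section PerfectLocalization.
Variables (R : realType) (K : perfectType R) (rho : cancellative K).
Implicit Types (l m : R) (u v : loc rho).
Local Notation r := (cval rho).
Local Notation i x := (lfrac rho x 0).

Lemma loc_char1 : 1 + 1 = 1 :> loc rho.
Proof. by rewrite [LHS]lfracD !mulr1 addr11. Qed.

HB.instance Definition _ := hasCharOne.Build (loc rho) loc_char1.

(* (x / rho ^ n) ^ l = x ^ l * rho ^ (N - l * n) / rho ^ N for any N > l * n *)
Definition loc_theta l u : loc rho :=
  let N := (Num.truncn (l * (repr u).2%:R)).+1 in
  lfrac rho (theta l (repr u).1 * ppow r (N%:R - l * (repr u).2%:R)) N.

Lemma loc_injM x y : i (x * y) = i x * i y.
Proof. by rewrite lfracM. Qed.

Lemma loc_injD x y : i (x + y) = i x + i y.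
Proof. by rewrite lfracD !mulr1. Qed.

Lemma loc_injX x n : i (x ^+ n) = i x ^+ n.
Proof. by elim: n => [//|n IH]; rewrite !exprS loc_injM IH. Qed.

Lemma lfracK x n : lfrac rho x n * i (r ^+ n) = i x.
Proof. by rewrite lfracM; apply/lfrac_eqP; rewrite addn0 mulr1. Qed.

Lemma loc_ppowI (a : R) u v : 0 <= a ->
  u * i (ppow r a) = v * i (ppow r a) -> u = v.
Proof.
move=> a0; set N := (Num.truncn a).+1.
have Na : 0 <= N%:R - a by rewrite subr_ge0 ltW // real_truncnS_gt ?num_real.
move=> /(congr1 (fun w => w * i (ppow r (N%:R - a)))).
rewrite -!mulrA -loc_injM ppowD // subrKC ppow_nat.
move=> /(congr1 (fun w => w * lfrac rho 1 N)); rewrite -!mulrA.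
have -> : i (r ^+ N) * lfrac rho 1 N = 1.
  by rewrite lfracM; apply/lfrac_eqP; rewrite !mulr1 mul1r.
by rewrite !mulr1.
Qed.

Lemma loc_thetaE l x n : 0 < l ->
  loc_theta l (lfrac rho x n) * i (ppow r (l * n%:R)) = i (theta l x).
Proof.
move=> l0; rewrite /loc_theta; have := repr_lfrac rho x n.
move: (repr _) => [y m] /= e; set N := _.+1.
have Na : 0 <= N%:R - l * m%:R by rewrite subr_ge0 ltW // real_truncnS_gt ?num_real.
have lk k : 0 <= l * k%:R :> R by rewrite mulr_ge0 // ltW.
apply: (@loc_ppowI (l * m%:R)) => //=.
rewrite -!mulrA -!loc_injM lfracM; apply/lfrac_eqP; rewrite mulr1 addn0.
rewrite -(@ppow_nat R K N) -[in RHS](subrK (l * m%:R) N%:R) -(ppowD _ Na (lk m)).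
have := congr1 (theta l) e; rewrite !thetaM // -!(@ppow_nat R K) !theta_ppow // => e'.
transitivity (theta l y * ppow r (l * n%:R) *
  (ppow r (N%:R - l * m%:R) * ppow r (l * m%:R))); first by ring.
by rewrite e'; ring.
Qed.

Lemma loc_theta_inj l x : 0 < l -> loc_theta l (i x) = i (theta l x).
Proof. by move=> l0; have := loc_thetaE x 0 l0; rewrite mulr0 ppow0 mulr1. Qed.

Let lge0 l n : 0 < l -> 0 <= l * n%:R.
Proof. by move=> l0; rewrite mulr_ge0 // ltW. Qed.

Lemma loc_thetaD l u v : 0 < l ->
  loc_theta l (u + v) = loc_theta l u + loc_theta l v.
Proof.
move=> l0; have [[x n] ->] := lfracP u; have [[y m] ->] := lfracP v; rewrite /=.
apply: (@loc_ppowI (l * (n + m)%:R)); first exact: lge0.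
rewrite lfracD loc_thetaE // natrD mulrDr -ppowD ?lge0 //.
rewrite theta_add // !thetaM // loc_injD !loc_injM -!(@ppow_nat R K).
rewrite !theta_ppow // -(loc_thetaE x n l0) -(loc_thetaE y m l0); ring.
Qed.

Lemma loc_thetaM l u v : 0 < l ->
  loc_theta l (u * v) = loc_theta l u * loc_theta l v.
Proof.
move=> l0; have [[x n] ->] := lfracP u; have [[y m] ->] := lfracP v; rewrite /=.
apply: (@loc_ppowI (l * (n + m)%:R)); first exact: lge0.
rewrite lfracM loc_thetaE // natrD mulrDr -ppowD ?lge0 //.
by rewrite !thetaM // !loc_injM -(loc_thetaE x n l0) -(loc_thetaE y m l0); ring.
Qed.

Lemma loc_theta_nmod l : 0 < l -> nmod_morphism (loc_theta l).
Proof.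
move=> l0; split; last by move=> u v; exact: loc_thetaD.
by rewrite [LHS]loc_theta_inj // theta0.
Qed.

Lemma loc_theta_monoid l : 0 < l -> monoid_morphism (loc_theta l).
Proof.
move=> l0; split; last by move=> u v; exact: loc_thetaM.
by rewrite [LHS]loc_theta_inj // theta1.
Qed.

Lemma loc_theta_nat n u : (0 < n)%N -> loc_theta n%:R u = u ^+ n.
Proof.
move=> n0; have [[x k] ->] := lfracP u; rewrite /=.
apply: (@loc_ppowI (n%:R * k%:R)); first exact: mulr_ge0.
rewrite loc_thetaE ?ltr0n // theta_nat // -natrM ppow_nat mulnC exprM.
by rewrite [i (_ ^+ n)]loc_injX [i ((_ ^+ _) ^+ n)]loc_injX -exprMn lfracK.
Qed.

Lemma loc_theta_comp l m u : 0 < l -> 0 < m ->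
  loc_theta l (loc_theta m u) = loc_theta (l * m) u.
Proof.
move=> l0 m0; have [[x n] ->] := lfracP u; rewrite /=.
apply: (@loc_ppowI (l * m * n%:R)); first by rewrite lge0 ?mulr_gt0.
rewrite [RHS]loc_thetaE ?mulr_gt0 // -mulrA -theta_ppow ?lge0 //.
by rewrite -loc_theta_inj // -loc_thetaM // loc_thetaE // loc_theta_inj // theta_comp.
Qed.

Lemma loc_theta_mul l m u : 0 < l -> 0 < m ->
  loc_theta l u * loc_theta m u = loc_theta (l + m) u.
Proof.
move=> l0 m0; have [[x n] ->] := lfracP u; rewrite /=.
apply: (@loc_ppowI ((l + m) * n%:R)); first by rewrite lge0 ?addr_gt0.
rewrite [RHS]loc_thetaE ?addr_gt0 // mulrDl -ppowD ?lge0 // loc_injM mulrACA.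
by rewrite !loc_thetaE // -loc_injM thetaD.
Qed.

HB.instance Definition _ := isPerfect.Build R (loc rho)
  loc_theta_nmod loc_theta_monoid loc_theta_nat loc_theta_comp loc_theta_mul.

(* rho ^ a in K_rho, for any real a *)
Definition rho_pow (a : R) : loc rho :=
  if 0 <= a then ppow (i r) a else ppow (loc_rho_inv rho) (- a).

(* ln 0 = 0, so that 0 * ln 0 = 0 as required at s = 0 and s = 1. *)
Definition entropy (s : R) : R := - s * ln s - (1 - s) * ln (1 - s).

Definition witt_integrand (x y : loc rho) (s : R) : loc rho :=
  rho_pow (- entropy s) * ppow x s * ppow y (1 - s).

Definition witt_add (x y : loc rho) : loc rho :=
  idem_int `[0, 1]%classic (witt_integrand x y).

End PerfectLocalization.

Section Grothendieck.
Variable V : nmodType.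

(* The pair (a, b) stands for the formal difference a - b. *)
Definition groth_eq (p q : V * V) : bool :=
  `[< exists k, p.1 + q.2 + k = q.1 + p.2 + k >].

Lemma groth_eq_refl : reflexive groth_eq.
Proof. by move=> p; apply/asboolP; exists 0. Qed.

Lemma groth_eq_sym : symmetric groth_eq.
Proof. by move=> p q; apply/asboolP/asboolP => -[k e]; exists k. Qed.

Lemma groth_eq_trans : transitive groth_eq.
Proof.
move=> q p t /asboolP[k e] /asboolP[k' e']; apply/asboolP.
exists (q.1 + q.2 + k + k').
have -> : p.1 + t.2 + (q.1 + q.2 + k + k') = (p.1 + q.2 + k) + (q.1 + t.2 + k').
  by rewrite [LHS](AC (2*4) ((1*4*5)*(3*2*6))).
by rewrite e e' (AC (3*3) ((4*2)*(1*5*3*6))).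
Qed.

Canonical groth_equiv :=
  EquivRel groth_eq groth_eq_refl groth_eq_sym groth_eq_trans.

Definition groth := {eq_quot groth_eq}.
HB.instance Definition _ : EqQuotient _ groth_eq groth := EqQuotient.on groth.
HB.instance Definition _ := Choice.on groth.

Definition gdiff (a b : V) : groth := \pi_groth (a, b).

Lemma gdiff_eqP a b c d :
  gdiff a b = gdiff c d <-> exists k, a + d + k = c + b + k.
Proof.
split=> [/eqP|e]; first by rewrite /gdiff eqmodE => /asboolP.
by apply/eqP; rewrite /gdiff eqmodE; apply/asboolP.
Qed.

Lemma gdiffP u : exists p : V * V, u = gdiff p.1 p.2.
Proof. by exists (repr u); rewrite /gdiff -surjective_pairing reprK. Qed.

Lemma repr_gdiff a b :
  exists k, (repr (gdiff a b)).1 + b + k = a + (repr (gdiff a b)).2 + k.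
Proof. by apply/gdiff_eqP; rewrite /gdiff -surjective_pairing reprK. Qed.

Definition groth_add (u v : groth) : groth :=
  gdiff ((repr u).1 + (repr v).1) ((repr u).2 + (repr v).2).

Definition groth_opp (u : groth) : groth := gdiff (repr u).2 (repr u).1.

Lemma groth_addE a b c d :
  groth_add (gdiff a b) (gdiff c d) = gdiff (a + c) (b + d).
Proof.
apply/gdiff_eqP; have [k] := repr_gdiff a b; have [k'] := repr_gdiff c d.
move: (repr (gdiff c d)) (repr (gdiff a b)) => [c' d'] [a' b'] /= e' e; exists (k + k').
by rewrite (AC (2*2*2) ((1*3*5)*(2*4*6))) /= e e' (AC (3*3) ((1*4)*(2*5)*(3*6))).
Qed.

Lemma groth_oppE a b : groth_opp (gdiff a b) = gdiff b a.
Proof.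
apply/gdiff_eqP; have [k] := repr_gdiff a b.
by move: (repr _) => [a' b'] /= e; exists k; rewrite [b' + a]addrC [b + a']addrC e.
Qed.

Lemma groth_addA : associative groth_add.
Proof.
move=> u v w.
have [[a b] ->] := gdiffP u; have [[c d] ->] := gdiffP v; have [[e f] ->] := gdiffP w.
by rewrite /= !groth_addE !addrA.
Qed.

Lemma groth_addC : commutative groth_add.
Proof.
move=> u v; have [[a b] ->] := gdiffP u; have [[c d] ->] := gdiffP v.
by rewrite /= !groth_addE addrC [b + d]addrC.
Qed.

Lemma groth_add0 : left_id (gdiff 0 0) groth_add.
Proof. by move=> u; have [[a b] ->] := gdiffP u; rewrite /= groth_addE !add0r. Qed.

Lemma groth_addN : left_inverse (gdiff 0 0) groth_opp groth_add.
Proof.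
move=> u; have [[a b] ->] := gdiffP u; rewrite /= groth_oppE groth_addE.
by apply/gdiff_eqP; exists 0; rewrite !addr0 add0r addrC.
Qed.

HB.instance Definition _ := GRing.isZmodule.Build groth
  groth_addA groth_addC groth_add0 groth_addN.

Definition groth_inj (a : V) : groth := gdiff a 0.

End Grothendieck.

Section GrothendieckRing.
Variable A : comPzSemiRingType.
Implicit Types u v w : groth A.

Definition groth_mul u v : groth A :=
  gdiff ((repr u).1 * (repr v).1 + (repr u).2 * (repr v).2)
        ((repr u).1 * (repr v).2 + (repr u).2 * (repr v).1).

Lemma groth_mulE (a b c d : A) :
  groth_mul (gdiff a b) (gdiff c d) = gdiff (a * c + b * d) (a * d + b * c).
Proof.
have [k] := repr_gdiff a b; have [k'] := repr_gdiff c d; rewrite /groth_mul.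
move: (repr (gdiff c d)) (repr (gdiff a b)) => [c' d'] [a' b'] /= e' e.
transitivity (gdiff (a * c' + b * d') (a * d' + b * c')); apply/gdiff_eqP.
  exists (k * (c' + d')).
  transitivity ((a' + b + k) * c' + (a + b' + k) * d'); first by ring.
  transitivity ((a + b' + k) * c' + (a' + b + k) * d'); last by ring.
  by rewrite e.
exists ((a + b) * k').
transitivity (a * (c' + d + k') + b * (c + d' + k')); first by ring.
transitivity (a * (c + d' + k') + b * (c' + d + k')); last by ring.
by rewrite e'.
Qed.

Lemma groth_mulA : associative groth_mul.
Proof.
move=> u v w.
have [[a b] ->] := gdiffP u; have [[c d] ->] := gdiffP v; have [[e f] ->] := gdiffP w.
by rewrite /= !groth_mulE; congr gdiff; ring.
Qed.

Lemma groth_mulC : commutative groth_mul.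
Proof.
move=> u v; have [[a b] ->] := gdiffP u; have [[c d] ->] := gdiffP v.
by rewrite /= !groth_mulE; congr gdiff; ring.
Qed.

Lemma groth_mul1 : left_id (gdiff 1 0) groth_mul.
Proof.
move=> u; have [[a b] ->] := gdiffP u.
by rewrite /= groth_mulE; congr gdiff; ring.
Qed.

Lemma groth_mulDl : left_distributive groth_mul +%R.
Proof.
move=> u v w.
have [[a b] ->] := gdiffP u; have [[c d] ->] := gdiffP v; have [[e f] ->] := gdiffP w.
rewrite /= [gdiff a b + _]groth_addE !groth_mulE [RHS]groth_addE.
by congr gdiff; ring.
Qed.

HB.instance Definition _ := GRing.Zmodule_isComPzRing.Build (groth A)
  groth_mulA groth_mulC groth_mul1 groth_mulDl.

End GrothendieckRing.

Section Witt.
Variable R : realType.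

(* The last field is the standing assumption on idempotent integrals; the
   remaining usual rules follow from it, since each theta l with 0 < l is an
   automorphism of the ordered set K_rho and least upper bounds are iterated. *)
Record witt_datum := WittDatum {
  wring :> perfectType R;
  wrho : cancellative wring;
  wrho_le1 : preceq (cval wrho) 1;
  wintegrable : forall x y : loc wrho,
    idem_integrable `[0, 1]%classic (witt_integrand x y)
}.

Record witt_hom (P Q : witt_datum) := WittHom {
  whom :> {rmorphism wring P -> wring Q};
  whom_rho : whom (cval (wrho P)) = cval (wrho Q);
  whom_theta : forall (l : R) x, 0 < l -> whom (theta l x) = theta l (whom x);
  whom_int : forall x y : loc (wrho P),
    loc_map (wrho Q) whom (idem_int `[0, 1]%classic (witt_integrand x y)) =
    idem_int `[0, 1]%classic
      (fun s => loc_map (wrho Q) whom (witt_integrand x y s))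
}.

Definition whom_loc P Q (f : witt_hom P Q) : loc (wrho P) -> loc (wrho Q) :=
  loc_map (wrho Q) f.

Section WittHomTheory.
Variables (P Q : witt_datum) (f : witt_hom P Q).
Implicit Types (x y u v : loc (wrho P)) (l s : R).

Lemma whom_lfrac z n : whom_loc f (lfrac (wrho P) z n) = lfrac (wrho Q) (f z) n.
Proof. exact/loc_map_lfrac/whom_rho. Qed.

Lemma whom_locM u v : whom_loc f (u * v) = whom_loc f u * whom_loc f v.
Proof.
have [[x n] ->] := lfracP u; have [[y m] ->] := lfracP v; rewrite /=.
by rewrite lfracM !whom_lfrac lfracM rmorphM.
Qed.

Lemma whom_loc1 : whom_loc f 1 = 1.
Proof. by rewrite [LHS]whom_lfrac rmorph1. Qed.

Lemma whom_loc_theta l u : 0 < l -> whom_loc f (theta l u) = theta l (whom_loc f u).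
Proof.
move=> l0; have ln n : 0 <= l * n%:R by rewrite mulr_ge0 // ltW.
have [[x n] ->] := lfracP u; rewrite /= whom_lfrac.
apply: (@loc_ppowI R _ _ (l * n%:R)) => //.
rewrite [RHS]loc_thetaE // -whom_theta // -whom_lfrac -(loc_thetaE _ x n l0) whom_locM.
congr (_ * _); rewrite whom_lfrac /ppow -(whom_rho f); case: eqP => [_|/eqP e].
  by rewrite rmorph1.
by rewrite -whom_theta // lt0r e ln.
Qed.

Lemma whom_ppow s u : 0 <= s -> whom_loc f (ppow u s) = ppow (whom_loc f u) s.
Proof.
rewrite le0r /ppow; case: eqP => [_ _|_ /= s0]; first exact: whom_loc1.
exact: whom_loc_theta.
Qed.

Lemma whom_rho_pow (a : R) :
  whom_loc f (rho_pow (wrho P) a) = rho_pow (wrho Q) a.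
Proof.
rewrite /rho_pow; case: (lerP 0 a) => a0.
  by rewrite whom_ppow // whom_lfrac whom_rho.
by rewrite whom_ppow ?oppr_ge0 ?ltW // whom_lfrac rmorph1.
Qed.

Lemma whom_integrand x y s : `[0, 1]%classic s ->
  whom_loc f (witt_integrand x y s) =
  witt_integrand (whom_loc f x) (whom_loc f y) s.
Proof.
rewrite /= in_itv /= => /andP[s0 s1].
by rewrite /witt_integrand !whom_locM whom_rho_pow !whom_ppow // subr_ge0.
Qed.

End WittHomTheory.

Lemma eq_idem_int (K : charOneType) (T : Type) (Y : set T) (f g : T -> K) :
  (forall t, Y t -> f t = g t) -> idem_int Y f = idem_int Y g.
Proof.
move=> fg; rewrite /idem_int; suff -> : f @` Y = g @` Y by [].
by apply/seteqP; split=> _ [t Yt <-]; exists t; rewrite // fg.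
Qed.

Lemma loc_map_id (K : comNzSemiRingType) (rho : cancellative K) (u : loc rho) :
  loc_map rho idfun u = u.
Proof. by rewrite /loc_map /lfrac -surjective_pairing reprK. Qed.

Lemma whom_loc_comp (P Q S : witt_datum) (f : witt_hom P Q) (g : witt_hom Q S) u :
  loc_map (wrho S) (g \o f) u = whom_loc g (whom_loc f u).
Proof.
have [[x n] ->] := lfracP u; rewrite /= !whom_lfrac.
by apply: loc_map_lfrac; rewrite /= !whom_rho.
Qed.

Section Identity.
Variable P : witt_datum.

Lemma witt_id_int (x y : loc (wrho P)) :
  loc_map (wrho P) idfun (idem_int `[0, 1]%classic (witt_integrand x y)) =
  idem_int `[0, 1]%classic
    (fun s => loc_map (wrho P) idfun (witt_integrand x y s)).
Proof. by rewrite loc_map_id; apply: eq_idem_int => s _; rewrite loc_map_id. Qed.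

Definition witt_id : witt_hom P P :=
  @WittHom P P idfun erefl (fun _ _ _ => erefl) witt_id_int.

End Identity.

Section Composition.
Variables (P Q S : witt_datum) (g : witt_hom Q S) (f : witt_hom P Q).

Lemma witt_comp_rho : (g \o f) (cval (wrho P)) = cval (wrho S).
Proof. by rewrite /= !whom_rho. Qed.

Lemma witt_comp_theta (l : R) x : 0 < l ->
  (g \o f) (theta l x) = theta l ((g \o f) x).
Proof. by move=> l0; rewrite /= !whom_theta. Qed.

Lemma witt_comp_int (x y : loc (wrho P)) :
  loc_map (wrho S) (g \o f) (idem_int `[0, 1]%classic (witt_integrand x y)) =
  idem_int `[0, 1]%classic
    (fun s => loc_map (wrho S) (g \o f) (witt_integrand x y s)).
Proof.
rewrite whom_loc_comp [whom_loc f _]whom_int.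
rewrite (eq_idem_int (whom_integrand f x y)) [LHS]whom_int.
by apply: eq_idem_int => s Ys; rewrite whom_loc_comp whom_integrand.
Qed.

Definition witt_comp : witt_hom P S :=
  @WittHom P S (g \o f) witt_comp_rho witt_comp_theta witt_comp_int.

End Composition.

(* Commutativity is included because the Grothendieck group is that of a
   commutative monoid. *)
Record witt_laws (P : witt_datum) : Prop := WittLaws {
  witt_addA : associative (@witt_add R P (wrho P));
  witt_addC : commutative (@witt_add R P (wrho P));
  witt_add0 : left_id 0 (@witt_add R P (wrho P));
  witt_mulDl : left_distributive *%R (@witt_add R P (wrho P))
}.

(* K_rho with its multiplication and the addition witt_add *)
Definition witt_semiring P (laws : witt_laws P) : Type := loc (wrho P).

Section WittSemiRing.
Variables (P : witt_datum) (laws : witt_laws P).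

HB.instance Definition _ := Choice.copy (witt_semiring laws) (loc (wrho P)).
HB.instance Definition _ := GRing.isNmodule.Build (witt_semiring laws)
  (witt_addA laws) (witt_addC laws) (witt_add0 laws).
HB.instance Definition _ := GRing.Nmodule_isComPzSemiRing.Build
  (witt_semiring laws) (@mulrA (loc (wrho P))) (@mulrC (loc (wrho P)))
  (@mul1r (loc (wrho P))) (witt_mulDl laws) (@mul0r (loc (wrho P))).

End WittSemiRing.

Definition witt P (laws : witt_laws P) : comPzRingType :=
  groth (witt_semiring laws).

Definition witt_inj P (laws : witt_laws P) (x : loc (wrho P)) : witt laws :=
  @groth_inj (witt_semiring laws) x.

(* An R-algebra structure on the ring A, which may be the zero ring (this is why
   algType, whose rings are nonzero, is not used). *)
Record algebra_structure (A : comPzRingType) := AlgebraStructure {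
  ascale :> R -> A -> A;
  ascaleA : forall a b u, ascale a (ascale b u) = ascale (a * b) u;
  ascale1 : forall u, ascale 1 u = u;
  ascaleDr : forall a u v, ascale a (u + v) = ascale a u + ascale a v;
  ascaleDl : forall a b u, ascale (a + b) u = ascale a u + ascale b u;
  ascaleAl : forall a u v, ascale a (u * v) = ascale a u * v
}.

End Witt.

(* Main.v *)
Require Import Defs.
From mathcomp Require Import all_boot all_order all_algebra.
From mathcomp Require Import all_classical reals.
From HB Require Import structures.
From mathcomp Require Import exp ring lra.

(** Write h(t) = t ln t, so that the weight of the integrand of x +_rho y at s
    is rho^(h(s) + h(1-s)).

    Associativity comes from the chain rule of the entropy (entropy_chain):
    splitting a probability vector (a, b, c) as a + b versus c, and then a
    versus b, the weights of the two successive integrals multiply to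
    rho^(h(a) + h(b) + h(c)).  Since multiplications by constants and the
    automorphisms theta preserve the least upper bounds at hand, (x +_rho y)
    +_rho z is the least upper bound of the elements
    rho^(h(a) + h(b) + h(c)) x^a y^b z^c over the two-dimensional simplex
    (witt_add3_lub).  That set is invariant under a cyclic rotation of (x, y, z),
    which together with the commutativity of +_rho (exchange s and 1 - s) gives
    associativity.  Distributivity holds because z = z^s z^(1-s), and 0 is
    neutral because the integrand of 0 +_rho y vanishes except at s = 0, where
    it is y.

    The scalars come from the map a |-> rho^(-ln a), 0 |-> 0, which is a
    morphism from the semiring of nonnegative reals to K_rho with the addition
    +_rho.  It is additive by Gibbs' inequality: the maximum over s of
    S(s) + s ln a + (1-s) ln b is ln (a+b), reached at s = a / (a+b).  Here
    rho <= 1 is used, as it makes u |-> rho^u decreasing, so that this maximum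
    of exponents is a supremum in K_rho (witt_add_rho_pow).  Passing to formal
    differences yields a ring morphism from R to the Grothendieck ring
    (real_witt), that is, an algebra structure.

    A morphism of the data commutes with products, powers of rho and the
    integrals, hence with +_rho and with the scalars; functoriality is then
    inherited from that of the Grothendieck construction (groth_map). *)

Set Implicit Arguments.
Unset Strict Implicit.
Unset Printing Implicit Defensive.

Import Order.TTheory GRing.Theory Num.Theory.
Local Open Scope ring_scope.
Local Open Scope classical_set_scope.

(** * Entropy and Gibbs' inequality *)

Section Entropy.
Variable R : realType.
Implicit Types a b s t p : R.

Definition xlnx t : R := t * ln t.

Lemma xlnx0 : xlnx 0 = 0.
Proof. by rewrite /xlnx mul0r. Qed.

(** This extends ln (s t) = ln s + ln t to the boundary of the simplex, where it
    is the convention 0 ln 0 = 0 that makes it true. *)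
Lemma xlnxM s t : 0 <= s -> 0 <= t -> xlnx (s * t) = t * xlnx s + s * xlnx t.
Proof.
rewrite !le0r => /orP[/eqP->|s0] /orP[/eqP->|t0];
  rewrite ?(mul0r, mulr0, xlnx0, addr0) //.
by rewrite /xlnx lnM ?posrE //; ring.
Qed.

Lemma entropyE s : - entropy s = xlnx s + xlnx (1 - s).
Proof. by rewrite /entropy /xlnx; ring. Qed.

(** The chain rule of Shannon entropy: choosing between s and 1 - s, and then
    splitting s in the proportion t : 1 - t, has the entropy of the resulting
    three-point distribution. *)
Lemma entropy_chain s t : 0 <= s -> 0 <= t -> t <= 1 ->
  - entropy s + s * - entropy t =
  xlnx (s * t) + xlnx (s * (1 - t)) + xlnx (1 - s).
Proof.
by move=> s0 t0 t1; rewrite !entropyE !xlnxM ?subr_ge0 //; ring.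
Qed.

(** Each term of Gibbs' inequality separately, from ln u <= u - 1 at u = p / s;
    the bounds p - s add up to 0 over a pair of probability distributions. *)
Lemma mul_ln_le s p : 0 <= s -> 0 < p -> s * ln p - xlnx s <= p - s.
Proof.
rewrite le0r => /orP[/eqP->|s0] p0; first by rewrite xlnx0 mul0r !subr0 ltW.
have ps0 : 0 < p / s by rewrite divr_gt0.
have h : ln (p / s) <= p / s - 1.
  have := @le_ln1Dx R (p / s - 1); rewrite subrKC; apply; lra.
have -> : s * ln p - xlnx s = s * ln (p / s).
  by rewrite ln_div ?posrE // /xlnx; ring.
apply: le_trans (ler_wpM2l (ltW s0) h) _.
by rewrite mulrBr mulr1 mulrCA mulfV ?mulr1 // gt_eqF.
Qed.

(** Nonnegativity of the relative entropy of (s, 1 - s) with respect to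
    (a / (a + b), b / (a + b)). *)
Lemma gibbs a b s : 0 < a -> 0 < b -> 0 <= s -> s <= 1 ->
  - ln (a + b) <= - entropy s + s * - ln a + (1 - s) * - ln b.
Proof.
move=> a0 b0 s0 s1; have m0 : 0 < a + b by rewrite addr_gt0.
have := mul_ln_le s0 (divr_gt0 a0 m0).
have s1' : 0 <= 1 - s by rewrite subr_ge0.
have := mul_ln_le s1' (divr_gt0 b0 m0).
rewrite entropyE !ln_div ?posrE //.
have : a / (a + b) + b / (a + b) = 1 by rewrite -mulrDl mulfV // gt_eqF.
move: (xlnx s) (xlnx (1 - s)) (a / _) (b / _) => u v p q pq; nra.
Qed.

Lemma gibbs_eq a b : 0 < a -> 0 < b -> let s := a / (a + b) in
  - entropy s + s * - ln a + (1 - s) * - ln b = - ln (a + b).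
Proof.
move=> a0 b0 s; have m0 : 0 < a + b by rewrite addr_gt0.
have e : 1 - s = b / (a + b) by rewrite /s; field; rewrite gt_eqF.
rewrite entropyE e /xlnx /s !ln_div ?posrE //.
have := e; rewrite /s => {}e.
rewrite -e; ring.
Qed.

End Entropy.

(** * Least upper bounds in idempotent semirings *)

Section Lub.
Variable K : charOneType.
Implicit Types (a b c k : K) (A : set K).

Lemma preceq_refl a : preceq a a.
Proof. by rewrite /preceq -[a]mulr1 -mulrDr addr11. Qed.

Lemma preceq_trans a b c : preceq a b -> preceq b c -> preceq a c.
Proof. by rewrite /preceq => ab <-; rewrite addrA ab. Qed.

Lemma preceq_anti a b : preceq a b -> preceq b a -> a = b.
Proof. by rewrite /preceq addrC => ab <-. Qed.

Lemma preceq_mul k a b : preceq a b -> preceq (k * a) (k * b).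
Proof. by rewrite /preceq -mulrDr => ->. Qed.

Lemma is_lub_uniq A a b : is_lub A a -> is_lub A b -> a = b.
Proof. by move=> [ua la] [ub lb]; apply: preceq_anti; [apply: la | apply: lb]. Qed.

Lemma is_lub_max A a : A a -> (forall b, A b -> preceq b a) -> is_lub A a.
Proof. by move=> Aa h; split=> // c; apply. Qed.

Lemma idem_int_eq (T : Type) (Y : set T) (f : T -> K) b :
  is_lub (f @` Y) b -> idem_int Y f = b.
Proof.
move=> fb; rewrite /idem_int; case: xgetP => [c _ fc|/(_ b)//].
exact: is_lub_uniq fc fb.
Qed.

Lemma is_lub_idem_int (T : Type) (Y : set T) (f : T -> K) :
  idem_integrable Y f -> is_lub (f @` Y) (idem_int Y f).
Proof. by move=> [b fb _]; rewrite (idem_int_eq fb). Qed.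

Lemma is_lub_mul_idem_int (T : Type) (Y : set T) (f : T -> K) c :
  idem_integrable Y f -> is_lub ((fun t => c * f t) @` Y) (c * idem_int Y f).
Proof. by move=> [b fb cfb]; rewrite (idem_int_eq fb). Qed.

End Lub.

(** * Real powers in perfect semirings *)

Section Powers.
Variables (R : realType) (K : perfectType R).
Implicit Types (l s : R) (x y k c : K).

Lemma preceq_theta l x y : 0 < l -> preceq x y -> preceq (theta l x) (theta l y).
Proof. by move=> l0; rewrite /preceq -theta_add // => ->. Qed.

Lemma preceq_ppow l x y : 0 <= l -> preceq x y -> preceq (ppow x l) (ppow y l).
Proof.
rewrite le0r /ppow; case: eqP => /= _ l0 xy; first exact: preceq_refl.
exact: preceq_theta.
Qed.

Lemma ppow1 x : ppow x (1 : R) = x.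
Proof. by rewrite ppow_theta ?theta_id. Qed.

Lemma ppow_one l : 0 <= l -> ppow (1 : K) l = 1.
Proof. by rewrite le0r /ppow; case: eqP => //= _ l0; rewrite theta1. Qed.

Lemma ppow_zero l : 0 < l -> ppow (0 : K) l = 0.
Proof. by move=> l0; rewrite ppow_theta // theta0. Qed.

Lemma ppowM l x y : 0 <= l -> ppow (x * y) l = ppow x l * ppow y l.
Proof.
by rewrite le0r /ppow; case: eqP => /= _ l0; rewrite ?mulr1 ?thetaM.
Qed.

Lemma ppow_ppow l s x : 0 <= l -> 0 <= s -> ppow (ppow x s) l = ppow x (l * s).
Proof.
rewrite le0r => /orP[/eqP->|l0] s0; first by rewrite mul0r !ppow0.
by rewrite [LHS]ppow_theta ?theta_ppow.
Qed.

(** As theta l is an automorphism of the ordered semiring, k * theta l is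
    theta l composed with the multiplication by theta (1 / l) k, and that
    multiplication commutes with the integral by integrability. *)
Lemma is_lub_theta_idem_int (T : Type) (Y : set T) (f : T -> K) k l :
  0 < l -> idem_integrable Y f ->
  is_lub ((fun t => k * theta l (f t)) @` Y) (k * theta l (idem_int Y f)).
Proof.
move=> l0 fi; have li : 0 < l^-1 by rewrite invr_gt0.
have lK x : theta l (theta l^-1 x) = x.
  by rewrite theta_comp // mulfV ?theta_id // gt_eqF.
have Kl x : theta l^-1 (theta l x) = x.
  by rewrite theta_comp // mulVf ?theta_id // gt_eqF.
have [ub least] := is_lub_idem_int fi.
split=> [_ [t Yt <-]|c hc].
  by apply/preceq_mul/preceq_theta => //; apply: ub; exists t.
have [_ /(_ (theta l^-1 c)) h] := is_lub_mul_idem_int (theta l^-1 k) fi.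
rewrite -[k]lK -[c]lK -(@thetaM R K l) //.
apply: preceq_theta => //; apply: h => _ [t Yt <-].
by rewrite -[f t]Kl -(@thetaM R K l^-1) //; apply: preceq_theta => //; apply: hc; exists t.
Qed.

End Powers.

(** * Real powers of rho in the localization *)

Section RhoPow.
Variables (R : realType) (K : perfectType R) (rho : cancellative K).
Implicit Types (a b l : R).
Local Notation rpow := (@rho_pow R K rho).
Local Notation r := (lfrac rho (cval rho) 0).

Lemma rho_pow0 : rpow 0 = 1.
Proof. by rewrite /rho_pow lexx ppow0. Qed.

(** The two branches of the definition of rho_pow are inverse to each other. *)
Lemma ppow_rhoV a : 0 <= a -> ppow (loc_rho_inv rho) a * ppow r a = 1.
Proof. by move=> a0; rewrite -ppowM // mulrC rho_invK ppow_one. Qed.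

(** Multiplying by a large enough power of rho turns every exponent into a
    nonnegative one, which reduces identities on rho_pow to identities on ppow;
    such a power is invertible by ppow_rhoV. *)
Lemma rho_powE a b : 0 <= b -> 0 <= a + b -> rpow a * ppow r b = ppow r (a + b).
Proof.
rewrite /rho_pow => b0 ab0; case: lerP => a0; first by rewrite ppowD.
have na0 : 0 <= - a by rewrite oppr_ge0 ltW.
by rewrite -{1}[b](addKr a) -(ppowD _ na0 ab0) mulrA ppow_rhoV // mul1r.
Qed.

Lemma rho_powD a b : rpow (a + b) = rpow a * rpow b.
Proof.
have abs_ge (c : R) : 0 <= c + `|c| by have := ler_norm (- c); rewrite normrN; lra.
have e0 : 0 <= `|a| + `|b| by rewrite addr_ge0.
rewrite -[LHS]mulr1 -[RHS]mulr1 -(ppow_rhoV e0) ![_ * (ppow _ _ * _)]mulrCA.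
congr (_ * _); rewrite rho_powE //; last first.
  by have := abs_ge a; have := abs_ge b; lra.
rewrite -(ppowD _ (normr_ge0 a) (normr_ge0 b)) mulrACA !rho_powE // ppowD //.
by congr ppow; ring.
Qed.

Lemma ppow_rho_pow l a : 0 <= l -> ppow (rpow a) l = rpow (l * a).
Proof.
rewrite le0r => /orP[/eqP->|l0]; first by rewrite ppow0 mul0r rho_pow0.
rewrite /rho_pow pmulr_rge0 //; case: lerP => a0; rewrite ppow_ppow ?(ltW l0) //.
  by rewrite mulrN.
by rewrite oppr_ge0 ltW.
Qed.

Hypothesis rho_le1 : preceq (cval rho) 1.

(** rho^(b - a) <= 1^(b - a) = 1 when a <= b. *)
Lemma rho_pow_le a b : a <= b -> preceq (rpow b) (rpow a).
Proof.
rewrite -subr_ge0 => ba; rewrite -[b](subrKC a) rho_powD -[X in preceq _ X]mulr1.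
apply: preceq_mul; rewrite /rho_pow ba -[X in preceq _ X](ppow_one _ ba).
apply: preceq_ppow => //.
by rewrite /preceq [LHS](lfracD rho) !mulr1 rho_le1.
Qed.

End RhoPow.

(** * The laws of the deformed addition *)

Section WittAddition.
Variables (R : realType) (P : witt_datum R).
Local Notation rho := (wrho P).
Implicit Types (x y z : loc rho) (a b c s t : R).
Local Notation rpow := (@rho_pow R _ rho).
Local Notation "x +w y" := (@witt_add R P rho x y) (at level 50, left associativity).

Let unit_itvP s : `[0%R, 1%R]%classic s <-> 0 <= s /\ s <= 1.
Proof. by rewrite /= in_itv /=; split=> [/andP|[-> ->]]. Qed.

Lemma witt_add_lub x y : is_lub (witt_integrand x y @` `[0, 1]) (x +w y).
Proof. exact/is_lub_idem_int/wintegrable. Qed.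

Lemma witt_addC_holds : commutative (@witt_add R P rho).
Proof.
suff h x y : witt_integrand x y @` `[0%R, 1%R] `<=` witt_integrand y x @` `[0%R, 1%R].
  move=> x y; apply: is_lub_uniq (witt_add_lub x y) _.
  suff -> : witt_integrand x y @` `[0, 1] = witt_integrand y x @` `[0, 1].
    exact: witt_add_lub.
  by apply/seteqP; split; apply: h.
move=> _ [s /unit_itvP[s0 s1] <-]; exists (1 - s); first by apply/unit_itvP; split; lra.
by rewrite /witt_integrand !entropyE subKr addrC mulrAC.
Qed.

Lemma witt_add0_holds : left_id 0 (@witt_add R P rho).
Proof.
move=> y; apply: idem_int_eq.
have f0 : witt_integrand 0 y 0 = y.
  rewrite /witt_integrand entropyE subr0 xlnx0 /xlnx ln1 mulr0 addr0.
  by rewrite rho_pow0 ppow0 ppow1 !mul1r.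
have f_gt0 s : 0 < s -> witt_integrand 0 y s = 0.
  by move=> s0; rewrite /witt_integrand ppow_zero // mulr0 mul0r.
apply: is_lub_max => [|_ [s /unit_itvP[s0 _] <-]].
  by exists 0 => //; apply/unit_itvP.
move: s0; rewrite le0r => /orP[/eqP->|/f_gt0 ->]; first by rewrite f0; apply: preceq_refl.
by rewrite /preceq add0r.
Qed.

(** Multiplication by z goes inside the integral, where z = z^s z^(1-s) is
    shared between the two powers. *)
Lemma witt_mulDl_holds : left_distributive *%R (@witt_add R P rho).
Proof.
move=> x y z; rewrite /witt_add mulrC.
apply: is_lub_uniq (is_lub_mul_idem_int z (wintegrable x y)) _.
suff -> : (fun t => z * witt_integrand x y t) @` `[0%R, 1%R]
    = witt_integrand (x * z) (y * z) @` `[0%R, 1%R] by exact: witt_add_lub.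
have e s : `[0, 1]%classic s ->
    z * witt_integrand x y s = witt_integrand (x * z) (y * z) s.
  move=> /unit_itvP[s0 s1]; rewrite /witt_integrand !ppowM ?subr_ge0 //.
  have ez : ppow z s * ppow z (1 - s) = z by rewrite ppowD ?subr_ge0 // subrKC ppow1.
  by rewrite -{1}ez; ring.
by apply/seteqP; split=> _ [s Ys <-]; exists s; rewrite // e.
Qed.

Definition simplex_term x y z a b c : loc rho :=
  rpow (xlnx a + xlnx b + xlnx c) * (ppow x a * ppow y b * ppow z c).

Definition simplex_terms x y z : set (loc rho) :=
  [set w | exists a b c, [/\ 0 <= a, 0 <= b, 0 <= c & a + b + c = 1]
           /\ simplex_term x y z a b c = w].

(** One value of the integrand of the iterated integral, with s = a + b and
    t = a / (a + b) as coordinates on the simplex. *)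
Lemma nested_integrandE x y z s t : 0 <= s -> 0 <= t -> t <= 1 ->
  rpow (- entropy s) * ppow (witt_integrand x y t) s * ppow z (1 - s) =
  simplex_term x y z (s * t) (s * (1 - t)) (1 - s).
Proof.
move=> s0 t0 t1; have t1' : 0 <= 1 - t by rewrite subr_ge0.
rewrite /simplex_term -entropy_chain // rho_powD /witt_integrand !ppowM //.
by rewrite ppow_rho_pow // !ppow_ppow // !mulrA.
Qed.

(** At s > 0 the outer integrand is the least upper bound of the elements of
    the simplex lying over s, by is_lub_theta_idem_int; at s = 0 it is the
    single element with a = b = 0. *)
Lemma witt_add3_lub x y z : is_lub (simplex_terms x y z) ((x +w y) +w z).
Proof.
have [ub least] := witt_add_lub (x +w y) z.
split=> [_ [a [b [c [[a0 b0 c0 abc] <-]]]]|w hw].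
  (* If s = 0 then t = 0, and both s * t and s * (1 - t) still have the
     expected value 0. *)
  pose s := a + b; pose t := a / s.
  have s0 : 0 <= s by rewrite /s addr_ge0.
  have s1 : s <= 1 by rewrite /s; lra.
  have [ea eb] : s * t = a /\ s * (1 - t) = b.
    rewrite /t; have [s0'|sN0] := eqVneq s 0.
      have [-> ->] : a = 0 /\ b = 0 by move: s0'; rewrite /s; lra.
      by rewrite s0' !mul0r.
    by rewrite /s in sN0 *; split; field.
  have t01 : 0 <= t /\ t <= 1.
    split; first by rewrite divr_ge0.
    move: s0; rewrite le0r => /orP[/eqP s0|s0]; first by rewrite /t s0 invr0 mulr0.
    by rewrite ler_pdivrMr // mul1r /s; lra.
  have ec : c = 1 - s by rewrite /s; lra.
  rewrite -ea -eb ec -nested_integrandE //; try by case: t01.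
  apply: (@preceq_trans _ _ (witt_integrand (x +w y) z s)); last first.
    by apply: ub; exists s => //; apply/unit_itvP.
  rewrite /witt_integrand ![_ * ppow z _]mulrC.
  apply/preceq_mul/preceq_mul/preceq_ppow => //.
  have [ub' _] := witt_add_lub x y.
  by apply: ub'; exists t => //; apply/unit_itvP.
apply: least => _ [s /unit_itvP[s0 s1] <-].
have nested t : `[0, 1]%classic t ->
    preceq (rpow (- entropy s) * ppow (witt_integrand x y t) s * ppow z (1 - s)) w.
  move=> /unit_itvP[t0 t1]; rewrite nested_integrandE //.
  apply: hw; exists (s * t), (s * (1 - t)), (1 - s); split=> //.
  by split; rewrite ?mulr_ge0 ?subr_ge0 //; ring.
move: s0; rewrite le0r => /orP[/eqP s0|s0].
  (* The zeroth powers make the term independent of t, so that t = 0 will do. *)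
  have /nested : `[0%R, 1%R]%classic (0 : R) by apply/unit_itvP.
  by rewrite /witt_integrand s0 !ppow0.
rewrite {1}/witt_integrand mulrAC (ppow_theta _ s0).
have [_] := is_lub_theta_idem_int (rpow (- entropy s) * ppow z (1 - s)) s0
  (wintegrable x y).
apply=> _ [t Yt <-]; rewrite mulrAC -(ppow_theta _ s0); exact: nested.
Qed.

Lemma simplex_terms_rot x y z : simplex_terms y z x = simplex_terms x y z.
Proof.
apply/seteqP; split=> _ [a [b [c [[a0 b0 c0 abc] <-]]]].
  exists c, a, b; split; first by split=> //; lra.
  by rewrite /simplex_term; congr (rpow _ * _); ring.
exists b, c, a; split; first by split=> //; lra.
by rewrite /simplex_term; congr (rpow _ * _); ring.
Qed.

(** By commutativity x + (y + z) = (y + z) + x, and the set whose least upper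
    bound is the latter is the one for (x + y) + z, rotated. *)
Lemma witt_addA_holds : associative (@witt_add R P rho).
Proof.
move=> x y z; rewrite witt_addC_holds; apply: is_lub_uniq (witt_add3_lub x y z).
by rewrite -simplex_terms_rot; exact: witt_add3_lub.
Qed.

Lemma witt_laws_hold : witt_laws P.
Proof.
split; [exact: witt_addA_holds|exact: witt_addC_holds|exact: witt_add0_holds|].
exact: witt_mulDl_holds.
Qed.

(** The integrand is again a power of rho, whose exponent is minimal at
    s = a / (a + b) by Gibbs' inequality; as rho <= 1, the corresponding value
    is the greatest one. *)
Lemma witt_add_rho_pow a b : 0 < a -> 0 < b ->
  rpow (- ln a) +w rpow (- ln b) = rpow (- ln (a + b)).
Proof.
move=> a0 b0; have m0 : 0 < a + b by rewrite addr_gt0.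
have e s : 0 <= s -> s <= 1 -> witt_integrand (rpow (- ln a)) (rpow (- ln b)) s =
    rpow (- entropy s + s * - ln a + (1 - s) * - ln b).
  by move=> s0 s1; rewrite /witt_integrand !ppow_rho_pow ?subr_ge0 // !rho_powD.
apply: idem_int_eq; apply: is_lub_max => [|_ [s /unit_itvP[s0 s1] <-]].
  have s0 : 0 <= a / (a + b) by rewrite divr_ge0 ?ltW.
  have s1 : a / (a + b) <= 1 by rewrite ler_pdivrMr // mul1r lerDl ltW.
  by exists (a / (a + b)); [apply/unit_itvP|rewrite e // gibbs_eq].
by rewrite e //; apply: rho_pow_le (@wrho_le1 R P) _ _ _; apply: gibbs.
Qed.

(** The default value 0 is the right image of 0; that it is also taken at
    negative reals makes real_witt uniform in the sign of its argument. *)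
Definition scalar a : loc rho := if 0 < a then rpow (- ln a) else 0.

Lemma scalar0 : scalar 0 = 0.
Proof. by rewrite /scalar ltxx. Qed.

Lemma scalar1 : scalar 1 = 1.
Proof. by rewrite /scalar ltr01 ln1 oppr0 rho_pow0. Qed.

Lemma scalarM a b : 0 <= a -> 0 <= b -> scalar (a * b) = scalar a * scalar b.
Proof.
rewrite !le0r => /orP[/eqP->|a0] /orP[/eqP->|b0];
  rewrite ?(mul0r, mulr0, scalar0) //.
by rewrite /scalar mulr_gt0 // a0 b0 lnM ?posrE // opprD rho_powD.
Qed.

Lemma scalarD a b : 0 <= a -> 0 <= b -> scalar (a + b) = scalar a +w scalar b.
Proof.
rewrite le0r => /orP[/eqP->|a0]; first by rewrite scalar0 add0r witt_add0_holds.
rewrite le0r => /orP[/eqP->|b0].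
  by rewrite scalar0 addr0 witt_addC_holds witt_add0_holds.
by rewrite /scalar addr_gt0 // a0 b0 witt_add_rho_pow.
Qed.

End WittAddition.

(** * Functoriality of the deformed addition *)

Section WittFunctor.
Variables (R : realType) (P Q : witt_datum R) (f : witt_hom P Q).

Lemma whom_loc_witt_add x y :
  whom_loc f (witt_add x y) = witt_add (whom_loc f x) (whom_loc f y).
Proof.
by rewrite [LHS]whom_int; apply: eq_idem_int => s Ys; apply: whom_integrand.
Qed.

Lemma whom_loc0 : whom_loc f 0 = 0.
Proof. by rewrite [LHS]whom_lfrac rmorph0. Qed.

Lemma whom_scalar a : whom_loc f (scalar P a) = scalar Q a.
Proof. by rewrite /scalar; case: ifP => _; [exact: whom_rho_pow|exact: whom_loc0]. Qed.

End WittFunctor.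

(** * Functoriality of the Grothendieck ring *)

Lemma gdiffB (V : nmodType) (p q r s : V) :
  gdiff p q - gdiff r s = gdiff (p + s) (q + r).
Proof. by rewrite [- _]groth_oppE [LHS]groth_addE. Qed.

Section GrothendieckFunctor.
Variables (A B : comPzSemiRingType) (f : {rmorphism A -> B}).

Definition groth_map (u : groth A) : groth B := gdiff (f (repr u).1) (f (repr u).2).

Lemma groth_map_gdiff a b : groth_map (gdiff a b) = gdiff (f a) (f b).
Proof.
apply/gdiff_eqP; have [k e] := repr_gdiff a b.
by exists (f k); rewrite -!rmorphD e.
Qed.

Lemma groth_map_is_zmod_morphism : zmod_morphism groth_map.
Proof.
move=> u v; have [[a b] ->] := gdiffP u; have [[c d] ->] := gdiffP v; rewrite /=.
by rewrite gdiffB !groth_map_gdiff gdiffB !rmorphD.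
Qed.

Lemma groth_map_is_monoid_morphism : monoid_morphism groth_map.
Proof.
split=> [|u v]; first by rewrite [LHS]groth_map_gdiff rmorph1 rmorph0.
have [[a b] ->] := gdiffP u; have [[c d] ->] := gdiffP v; rewrite /=.
rewrite [_ * _]groth_mulE !groth_map_gdiff [RHS]groth_mulE.
by rewrite !rmorphD !rmorphM.
Qed.

HB.instance Definition _ :=
  GRing.isZmodMorphism.Build (groth A) (groth B) groth_map groth_map_is_zmod_morphism.
HB.instance Definition _ :=
  GRing.isMonoidMorphism.Build (groth A) (groth B) groth_map groth_map_is_monoid_morphism.

End GrothendieckFunctor.

Section WittMap.
Variables (R : realType) (P Q : witt_datum R) (f : witt_hom P Q).
Local Notation WP := (witt_semiring (witt_laws_hold P)).
Local Notation WQ := (witt_semiring (witt_laws_hold Q)).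

Definition witt_semiring_map : WP -> WQ := whom_loc f.

Lemma witt_semiring_map_is_nmod_morphism : nmod_morphism witt_semiring_map.
Proof. by split; [exact: whom_loc0 | exact: whom_loc_witt_add]. Qed.

Lemma witt_semiring_map_is_monoid_morphism : monoid_morphism witt_semiring_map.
Proof. by split; [exact: whom_loc1 | exact: whom_locM]. Qed.

HB.instance Definition _ := GRing.isNmodMorphism.Build WP WQ witt_semiring_map
  witt_semiring_map_is_nmod_morphism.
HB.instance Definition _ := GRing.isMonoidMorphism.Build WP WQ witt_semiring_map
  witt_semiring_map_is_monoid_morphism.

Definition witt_map : {rmorphism witt (witt_laws_hold P) -> witt (witt_laws_hold Q)} :=
  groth_map witt_semiring_map.

Lemma witt_map_gdiff (x y : WP) :
  witt_map (gdiff x y) = @gdiff WQ (whom_loc f x) (whom_loc f y).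
Proof. exact: groth_map_gdiff. Qed.

End WittMap.

(** * The algebra structure over the reals *)

Section WittAlgebra.
Variables (R : realType) (P : witt_datum R).
Local Notation WP := (witt_semiring (witt_laws_hold P)).
Implicit Types a b p q : R.

(** At most one of the two terms is nonzero: this is the difference of the
    images of the positive and negative parts of a. *)
Definition real_witt a : witt (witt_laws_hold P) :=
  @gdiff WP (scalar P a) (scalar P (- a)).

Lemma scalar_wittD a b : 0 <= a -> 0 <= b ->
  (scalar P a : WP) + (scalar P b : WP) = scalar P (a + b).
Proof. by move=> a0 b0; rewrite scalarD. Qed.

Lemma scalar_wittM a b : 0 <= a -> 0 <= b ->
  (scalar P a : WP) * (scalar P b : WP) = scalar P (a * b).
Proof. by move=> a0 b0; rewrite scalarM. Qed.

(** The Grothendieck ring only sees the difference of two nonnegative reals,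
    so that the morphism laws of real_witt can be checked on any decomposition
    of its arguments. *)
Lemma gdiff_scalar p q : 0 <= p -> 0 <= q ->
  @gdiff WP (scalar P p) (scalar P q) = real_witt (p - q).
Proof.
move=> p0 q0; rewrite /real_witt opprB; apply/gdiff_eqP; exists 0; rewrite !addr0.
have scalar_le0 a : a <= 0 -> scalar P a = 0 by rewrite /scalar ltNge => ->.
have [pq|/ltW pq] := lerP p q.
  rewrite [scalar P (p - q)]scalar_le0 ?subr_le0 // [RHS]add0r.
  have qp0 : 0 <= q - p by rewrite subr_ge0.
  by rewrite -[in RHS](subrKC p q) (scalarD _ p0 qp0).
have pq0 : 0 <= p - q by rewrite subr_ge0.
rewrite [scalar P (q - p)]scalar_le0 ?subr_le0 // [LHS]addr0.
by rewrite -[in LHS](subrK q p) (scalarD _ pq0 q0).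
Qed.

Lemma real_splitP a : exists p q, [/\ 0 <= p, 0 <= q & a = p - q].
Proof.
exists (a + `|a|), `|a|; split; rewrite ?addrK ?normr_ge0 //.
by have := ler_norm (- a); rewrite normrN; lra.
Qed.

Lemma real_witt_is_zmod_morphism : zmod_morphism real_witt.
Proof.
move=> a b; have [p [q [p0 q0 ->]]] := real_splitP a.
have [r [s [r0 s0 ->]]] := real_splitP b.
rewrite -(gdiff_scalar p0 q0) -(gdiff_scalar r0 s0).
rewrite gdiffB !scalar_wittD // gdiff_scalar ?addr_ge0 //.
by congr real_witt; ring.
Qed.

Lemma real_witt_is_monoid_morphism : monoid_morphism real_witt.
Proof.
split.
  by rewrite -[1](subr0 1) -gdiff_scalar // scalar1 scalar0.
move=> a b; have [p [q [p0 q0 ->]]] := real_splitP a.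
have [r [s [r0 s0 ->]]] := real_splitP b.
rewrite -(gdiff_scalar p0 q0) -(gdiff_scalar r0 s0) [RHS]groth_mulE.
rewrite !scalar_wittM // !scalar_wittD ?mulr_ge0 //.
rewrite gdiff_scalar ?addr_ge0 ?mulr_ge0 //.
by congr real_witt; ring.
Qed.

HB.instance Definition _ := GRing.isZmodMorphism.Build R _ real_witt
  real_witt_is_zmod_morphism.
HB.instance Definition _ := GRing.isMonoidMorphism.Build R _ real_witt
  real_witt_is_monoid_morphism.

End WittAlgebra.

(** A commutative ring is an algebra through any ring morphism from R; the
    definition is transparent so that the action unfolds to a product. *)
Definition algebra_of_rmorphism (R : realType) (A : comPzRingType)
    (h : {rmorphism R -> A}) : algebra_structure R A.
Proof.
refine (@AlgebraStructure R A (fun a u => h a * u) _ _ _ _ _).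
- by move=> a b u; rewrite rmorphM mulrA.
- by move=> u; rewrite rmorph1 mul1r.
- by move=> a u v; rewrite mulrDr.
- by move=> a b u; rewrite rmorphD mulrDl.
- by move=> a u v; rewrite mulrA.
Defined.

Lemma witt_map_real (R : realType) (P Q : witt_datum R) (f : witt_hom P Q) (a : R) :
  witt_map f (real_witt P a) = real_witt Q a.
Proof. by rewrite /real_witt witt_map_gdiff !whom_scalar. Qed.

Lemma witt_map_scale (R : realType) (P Q : witt_datum R) (f : witt_hom P Q) (a : R) u :
  witt_map f (algebra_of_rmorphism (real_witt P) a u) =
  algebra_of_rmorphism (real_witt Q) a (witt_map f u).
Proof. by rewrite [LHS]rmorphM witt_map_real. Qed.

Lemma witt_map_inj (R : realType) (P Q : witt_datum R) (f : witt_hom P Q) x :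
  witt_map f (witt_inj (witt_laws_hold P) x) = witt_inj (witt_laws_hold Q) (whom_loc f x).
Proof. by rewrite [LHS]witt_map_gdiff whom_loc0. Qed.

Lemma witt_map_id (R : realType) (P : witt_datum R) (u : witt (witt_laws_hold P)) :
  witt_map (witt_id P) u = u.
Proof.
have [[x y] ->] := gdiffP u.
rewrite [LHS]witt_map_gdiff.
by rewrite /whom_loc !loc_map_id.
Qed.

Lemma witt_map_comp (R : realType) (P Q S : witt_datum R) (g : witt_hom Q S)
    (f : witt_hom P Q) (u : witt (witt_laws_hold P)) :
  witt_map (witt_comp g f) u = witt_map g (witt_map f u).
Proof.
have [[x y] ->] := gdiffP u.
rewrite [LHS]witt_map_gdiff [witt_map f _]witt_map_gdiff [RHS]witt_map_gdiff.
by congr gdiff; exact: whom_loc_comp.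
Qed.

Theorem theorem2p20 (R : realType) :
  exists laws : forall P : witt_datum R, witt_laws P,
  exists alg : forall P : witt_datum R, algebra_structure R (witt (laws P)),
  exists F : forall P Q : witt_datum R, witt_hom P Q ->
               {rmorphism witt (laws P) -> witt (laws Q)},
    (forall P Q (f : witt_hom P Q) (a : R) (u : witt (laws P)),
       F P Q f (alg P a u) = alg Q a (F P Q f u)) /\
    (forall P Q (f : witt_hom P Q) (x : loc (wrho P)),
       F P Q f (witt_inj (laws P) x) = witt_inj (laws Q) (whom_loc f x)) /\
    (forall P (u : witt (laws P)), F P P (witt_id P) u = u) /\
    (forall P Q S (g : witt_hom Q S) (f : witt_hom P Q) (u : witt (laws P)),
       F P S (witt_comp g f) u = F Q S g (F P Q f u)).
Proof.
exists (@witt_laws_hold R).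
exists (fun P => algebra_of_rmorphism (real_witt P)).
exists (@witt_map R); split; first exact: witt_map_scale.
split; first exact: witt_map_inj.
split; [exact: witt_map_id | exact: witt_map_comp].
Qed.
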